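(* Let $m\ge 259$ be an odd integer and let $G$ be a finite simple graph with exactly $m$ edges and no isolated vertices. If $G$ is $\{H(3,3),H(4,3)\}$-free, then $$\rho(G)\le \frac{1+\sqrt{4m-3}}{2},$$ with equality if and only if $G\cong S_{\frac{m+3}{2},2}$.
   Context: For a finite simple graph $G$, $\rho(G)$ denotes its spectral radius, i.e. the largest eigenvalue of its adjacency matrix; the size of a graph is its number of edges. For $\ell\ge 3$, $H(\ell,3)$ is the graph formed by a cycle of length $\ell$ and a triangle sharing exactly one common vertex (and no other vertices). For a family $\mathcal{H}$ of graphs, $G$ is $\mathcal{H}$-free if it contains no subgraph (not necessarily induced) isomorphic to a member of $\mathcal{H}$. For $1\le k\le n$, $S_{n,k}$ is the graph of order $n$ obtained by joining each vertex of the complete graph $K_k$ to each of $n-k$ further pairwise non-adjacent vertices. In particular $S_{\frac{m+3}{2},2}$ (for $m$ odd) is the join of $K_2$ with $\frac{m-1}{2}$ isolated vertices, and has $m$ edges. *)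

(* Defs.v *)
From HB Require Import structures.
From mathcomp Require Import all_boot all_order all_algebra.
From mathcomp Require Import boolp classical_sets reals spectral polyrcf complex.

Set Implicit Arguments.
Unset Strict Implicit.
Unset Printing Implicit Defensive.

Import Order.TTheory GRing.Theory Num.Theory.

Local Open Scope ring_scope.

Record sgraph := SGraph {
  vertex :> finType;
  adj : rel vertex;
  adj_sym : symmetric adj;
  adj_irrefl : irreflexive adj }.

Arguments adj {s}.

Definition edges (G : sgraph) : {set {set G}} :=
  [set [set p.1; p.2] | p : G * G & adj p.1 p.2].

Definition no_isolated (G : sgraph) := forall x : G, exists y : G, adj x y.

(* Subgraphs are not required to be induced: only adjacency is preserved, not
   non-adjacency. *)
Definition contains (G H : sgraph) :=
  exists f : H -> G, injective f /\ forall x y, adj x y -> adj (f x) (f y).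

Definition family_free (F : sgraph -> Prop) (G : sgraph) :=
  forall H, F H -> ~ contains G H.

Definition isomorphic (G H : sgraph) :=
  exists f : G -> H, bijective f /\ forall x y, adj (f x) (f y) = adj x y.

Definition adjmx (R : nzRingType) (G : sgraph) : 'M[R]_#|G| :=
  \matrix_(i, j) (adj (enum_val i) (enum_val j))%:R.

Definition largest_eigenvalue (F : numFieldType) n (A : 'M[F]_n) (r : F) :=
  eigenvalue A r /\ forall a, eigenvalue A a -> a <= r.

(* The default value 0 is only taken by the graph with no vertices: see
   spectral_radiusP. *)
Definition spectral_radius (R : realType) (G : sgraph) : R :=
  xget 0 [set r | largest_eigenvalue (adjmx R G) r]%classic.

Lemma adjmx_tr (R : nzRingType) (G : sgraph) : (adjmx R G)^T = adjmx R G.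
Proof. by apply/matrixP => i j; rewrite !mxE adj_sym. Qed.

Lemma symmetric_eigenvalue (R : rcfType) n (A : 'M[R]_n.+1) :
  A^T = A -> exists a, eigenvalue A a.
Proof.
move=> Asym; pose B : 'M[R[i]]_n.+1 := map_mx (real_complex R) A.
have Bherm : B \is hermitianmx _ false Num.conj.
  apply: realsym_hermsym; last first.
    by apply/mxOverP => i j; rewrite mxE complex_real.
  apply/is_hermitianmxP; rewrite expr0 scale1r.
  by apply/matrixP => i j; rewrite !mxE -{1}Asym mxE.
have /hermitian_normalmx/orthomx_spectralP defB := Bherm.
have /mxOverP/(_ ord0 ord0)/complex_realP[k dk] :=
  hermitian_spectral_diag_real Bherm.
exists k; rewrite eigenvalue_root_char -(fmorph_root (real_complex R)).
rewrite map_char_poly -eigenvalue_root_char -/B.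
have Pu := spectral_unit B.
apply/eigenvalueP; exists (row ord0 (spectralmx B)).
  rewrite -row_mul {2}defB !mulmxA mulmxV // mul1mx row_mul.
  by rewrite row_diag_mx dk -scalemxAl -rowE.
have := Pu; rewrite -row_free_unit => /row_free_inj inj; apply/eqP => r0.
have : delta_mx ord0 ord0 = 0 :> 'M[R[i]]_(1, n.+1).
  by apply: inj; rewrite -rowE r0 mul0mx.
by move/matrixP/(_ ord0 ord0)/eqP; rewrite !mxE !eqxx oner_eq0.
Qed.

Lemma spectral_radiusP (R : realType) (G : sgraph) : (0 < #|G|)%N ->
  largest_eigenvalue (adjmx R G) (spectral_radius R G).
Proof.
move=> G0; rewrite /spectral_radius.
apply: (@xgetPex _ _ [set r | largest_eigenvalue (adjmx R G) r]%classic).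
have := adjmx_tr R G; move: (adjmx R G) G0.
case: #|_| => // n A _ /symmetric_eigenvalue[a0 Aa0].
have p0 : char_poly A != 0 by rewrite monic_neq0 // char_poly_monic.
have evE a : (a \in rootsR (char_poly A)) = eigenvalue A a.
  by rewrite eigenvalue_root_char -roots_on_rootsR // in_itv.
pose r := \big[Order.max/a0]_(a <- rootsR (char_poly A)) a.
exists r; split; last by move=> a; rewrite -evE => /le_bigmax_seq; apply.
rewrite /r big_seq; elim/big_ind: _ => // [x y Ax Ay|a]; last by rewrite evE.
by case: leP.
Qed.

(* Lengths l < 3 give degenerate graphs, which are not cycles with a triangle. *)
Section CycleTriangle.
Variable l : nat.

(* inl 0, ..., inl l.-1 are the vertices of the cycle, in cyclic order; the
   triangle is formed by inl 0, inr false and inr true. *)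
Definition cycle_triangle_adj (u v : 'I_l + bool) : bool :=
  match u, v with
  | inl i, inl j =>
      (i != j) && ((j == i.+1 %% l :> nat) || (i == j.+1 %% l :> nat))%N
  | inl i, inr _ => i == 0%N :> nat
  | inr _, inl j => j == 0%N :> nat
  | inr a, inr b => a != b
  end.

Fact cycle_triangle_sym : symmetric cycle_triangle_adj.
Proof. by case=> [i|a] [j|b] //=; rewrite eq_sym // orbC. Qed.

Fact cycle_triangle_irrefl : irreflexive cycle_triangle_adj.
Proof. by case=> [i|a] /=; rewrite eqxx. Qed.

Definition cycle_triangle := SGraph cycle_triangle_sym cycle_triangle_irrefl.

End CycleTriangle.

Section CompleteSplit.
Variables n k : nat.

Definition complete_split_adj (u v : 'I_k + 'I_(n - k)) : bool :=
  match u, v with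
  | inl i, inl j => i != j
  | inr _, inr _ => false
  | _, _ => true
  end.

Fact complete_split_sym : symmetric complete_split_adj.
Proof. by case=> [i|a] [j|b] //=; rewrite eq_sym. Qed.

Fact complete_split_irrefl : irreflexive complete_split_adj.
Proof. by case=> [i|a] //=; rewrite eqxx. Qed.

(* This has order n only when k <= n, the subtraction being truncated. *)
Definition complete_split := SGraph complete_split_sym complete_split_irrefl.

End CompleteSplit.

(* Main.v *)
(** Let r be the spectral radius, x an eigenvector for it and y = |x|, scaled so
    that its maximum is y u = 1; then r y <= M y entrywise, M being the adjacency
    matrix. Put A = N(u) and B = V \ N[u], and let dA and dB count the
    neighbours in A and in B. Bounding the entry of M^2 y - M y at u from below by
    r^2 - r and comparing it with the number m of edges gives
      m - (r^2 - r) >= sum_A (dA/2 - (dA - 1) y) + sum_B dA (1 - y) + e(B).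
    As H(3,3) is excluded, any two edges inside A meet, so they form a star or a
    triangle. A triangle makes the first sum larger than 1 because
    sum_A y >= r is large; a star makes it at least 1. Hence r^2 - r <= m - 1, and
    equality forces a spanning star in A, no edge in B, and y w = 1 for
    each w in B. Such a w would have at least r neighbours in A, which yields a
    4-cycle through u and w and a triangle through u and the centre of the
    star, that is, H(4,3). So B is empty and G is the join of K_2 with
    isolated vertices. *)

Require Import Defs.
From mathcomp Require Import all_boot all_order all_algebra.
From mathcomp Require Import reals.
From mathcomp Require Import ring lra zify.

Set Implicit Arguments.
Unset Strict Implicit.
Unset Printing Implicit Defensive.

Import Order.TTheory GRing.Theory Num.Theory.

Local Open Scope ring_scope.

(** * Eigenvectors as functions on vertices, and preliminaries on graphs *)

Lemma eigenvalue_adjmxP (R : realType) (G : sgraph) (r : R) :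
  reflect (exists2 x : G -> R, exists g, x g != 0 &
             forall g, \sum_h (adj g h)%:R * x h = r * x g)
          (eigenvalue (adjmx R G) r).
Proof.
apply: (iffP eigenvalueP) => [[v vA v0]|[x [g xg0] xE]].
  exists (fun g => v 0 (enum_rank g)) => [|g].
    have [i vi] : exists i, v 0 i != 0.
      apply/existsP; apply: contraNT v0; rewrite negb_exists => /forallP v0.
      apply/eqP/rowP => i; rewrite mxE; apply/eqP.
      by have := v0 i; rewrite negbK.
    by exists (enum_val i); rewrite enum_valK.
  have := congr1 (fun w : 'rV_#|G| => w 0 (enum_rank g)) vA.
  rewrite !mxE => <-; rewrite (reindex (@enum_val (vertex G) (vertex G))) /=; last first.
    by apply: onW_bij; exact: enum_val_bij.
  apply: eq_bigr => i _.
  by rewrite mxE enum_valK enum_rankK adj_sym mulrC.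
exists (\row_i x (enum_val i)).
  apply/rowP => j; rewrite !mxE -xE (reindex (@enum_val (vertex G) (vertex G))) /=; last first.
    by apply: onW_bij; exact: enum_val_bij.
  by apply: eq_bigr => i _; rewrite !mxE adj_sym mulrC.
apply/eqP => /rowP/(_ (enum_rank g)); rewrite !mxE enum_rankK => x0.
by rewrite x0 eqxx in xg0.
Qed.

Lemma eq_set2 (T : finType) (a b c d : T) :
  [set a; b] = [set c; d] -> (a, b) = (c, d) \/ (a, b) = (d, c).
Proof.
move=> e.
have := set21 a b; rewrite e !inE; have := set22 a b; rewrite e !inE.
have := set21 c d; rewrite -e !inE; have := set22 c d; rewrite -e !inE.
by do 4![case/orP=> /eqP ?]; subst; auto.
Qed.

Lemma handshake (G : sgraph) :
  (\sum_(g : G) \sum_(h : G) adj g h = 2 * #|edges G|)%N.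
Proof.
rewrite pair_big /=.
transitivity (\sum_(p in [set p : G * G | adj p.1 p.2]) 1)%N.
  by rewrite [RHS]big_mkcond; apply: eq_bigr => p _; rewrite inE; case: adj.
(* Ordered adjacent pairs are grouped by their underlying edge; each fibre is {(a, b), (b, a)}, of
   size two because there are no loops. *)
rewrite (partition_big_imset (fun p : G * G => [set p.1; p.2])) /=.
have -> : (fun p : G * G => [set p.1; p.2]) @: [set p | adj p.1 p.2] = edges G.
  by apply/setP => e; apply/imsetP/imsetP => -[p]; rewrite inE => ? ->;
    exists p => //; rewrite ?inE.
rewrite mulnC -sum_nat_const; apply: eq_bigr => e /imsetP[[a b]]; rewrite inE /=.
move=> ab ->; rewrite sum1dep_card.
have -> : [set x : G * G | x \in [set p | adj p.1 p.2]
            & [set x.1; x.2] == [set a; b]] = [set (a, b); (b, a)].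
  apply/setP=> -[c d]; rewrite !inE /=; apply/andP/orP.
    by case=> _ /eqP/eq_set2[] ->; rewrite eqxx; auto.
  by case=> /eqP[-> ->]; rewrite ?[adj b a]adj_sym ab ?[[set b; a]]setUC eqxx.
rewrite cards2 xpair_eqE; case: eqP ab => //= ->.
by rewrite adj_irrefl.
Qed.

(** Take an edge ab. If neither a nor b covers all edges, some edge avoids a and so passes through
    b, and some edge avoids b and so passes through a. These two meet, hence close a triangle abc,
    and an edge meeting all three sides stays inside it. Without edges, any element of [A] serves as
    centre. *)
Lemma intersecting_edges (T : finType) (A : {set T}) (e : rel T) :
  symmetric e -> irreflexive e -> (exists c, c \in A) ->
  (forall a b c d, a \in A -> b \in A -> c \in A -> d \in A ->
     e a b -> e c d -> [|| a == c, a == d, b == c | b == d]) ->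
  (exists2 c, c \in A & forall v w, v \in A -> w \in A -> e v w ->
     (v == c) || (w == c)) \/
  (exists a b c, forall v w, v \in A -> w \in A -> e v w ->
     v \in [set a; b; c] /\ w \in [set a; b; c]).
Proof.
move=> es ei [c0 c0A] H.
pose star c := [forall v in A, forall w in A, e v w ==> (v == c) || (w == c)].
have starP c : star c -> forall v w, v \in A -> w \in A -> e v w ->
    (v == c) || (w == c).
  by move=> /forall_inP sc v w vA wA; move: (sc v vA) => /forall_inP/(_ w wA)/implyP.
have nstarP c : ~~ star c -> exists v w, [/\ v \in A, w \in A, e v w, v != c & w != c].
  case/forall_inPn => v vA /forall_inPn[w wA]; rewrite negb_imply negb_or.
  by case/and3P=> *; exists v, w; split.
have [|/nstarP[a [b [aA bA eab _ _]]]] := boolP (star c0).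
  by move=> /starP s0; left; exists c0.
have [/starP|/nstarP[b' [c [b'A cA ebc b'a ca]]]] := boolP (star a).
  by left; exists a.
have [/starP|/nstarP[a' [c' [a'A c'A eac a'b c'b]]]] := boolP (star b).
  by left; exists b.
right.
wlog bE : b' c b'A cA ebc b'a ca / b' = b.
  move=> W; have := H a b b' c aA bA b'A cA eab ebc.
  rewrite [a == b']eq_sym [a == c]eq_sym (negPf b'a) (negPf ca) /=.
  by case/orP=> /eqP E; [apply: (W b' c)|apply: (W c b')]; rewrite // es.
wlog aE : a' c' a'A c'A eac a'b c'b / a' = a.
  move=> W; have := H a b a' c' aA bA a'A c'A eab eac.
  rewrite [b == a']eq_sym [b == c']eq_sym (negPf a'b) (negPf c'b) /= orbF.
  by case/orP=> /eqP E; [apply: (W a' c')|apply: (W c' a')]; rewrite // es.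
subst b' a'.
have c'E : c' = c.
  have := H b c a c' bA cA aA c'A ebc eac.
  by rewrite [b == a]eq_sym [b == c']eq_sym (negPf a'b) (negPf c'b) (negPf ca)
    => /= /eqP.
subst c'; exists a, b, c => v w vA wA evw; rewrite !inE.
have := H a b v w aA bA vA wA eab evw.
have := H b c v w bA cA vA wA ebc evw.
have := H a c v w aA cA vA wA eac evw.
rewrite ![_ == v]eq_sym ![_ == w]eq_sym.
have : v != w by apply: contraTneq evw => ->; rewrite ei.
have : [&& a != b, b != c & a != c].
  by rewrite a'b /= [b == c]eq_sym c'b eq_sym.
case: (v =P a) (w =P a) (v =P b) (w =P b) (v =P c) (w =P c)
  => [->|va] [->|wa] [?|vb] [?|wb] [?|vc] [?|wc] //=; subst;
  by rewrite ?eqxx ?andbF.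
Qed.

(** Here [p] lists the cycle in order from the shared vertex [u], and [c], [d] complete the
    triangle. *)
Lemma contains_cycle_triangle (G : sgraph) (l : nat) (p : seq G) (u c d : G) :
  size p = l -> nth u p 0 = u ->
  (forall i, (i < l)%N -> adj (nth u p i) (nth u p (i.+1 %% l))) ->
  uniq [:: c, d & p] -> adj u c -> adj u d -> adj c d ->
  contains G (cycle_triangle l).
Proof.
move=> sp p0 cyc /=; rewrite inE negb_or => /and3P[/andP[cd cp] dp up] uc ud adjcd.
exists (fun v : 'I_l + bool => match v with
  | inl i => nth u p i | inr b => if b then d else c end); split.
  move=> [i|b] [j|b'] //=.
  - by move/eqP; rewrite nth_uniq ?sp // => /eqP/val_inj->.
  - move=> E; have := mem_nth u (_ : i < size p)%N; rewrite sp => /(_ (ltn_ord i)).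
    by rewrite E; case: b' {E}; rewrite ?(negPf cp) ?(negPf dp).
  - move=> E; have := mem_nth u (_ : j < size p)%N; rewrite sp => /(_ (ltn_ord j)).
    by rewrite -E; case: b {E}; rewrite ?(negPf cp) ?(negPf dp).
  - by case: b b' => [] [] // E; rewrite E eqxx in cd.
move=> [i|b] [j|b'] /=.
- case/andP=> _ /orP[] /eqP->; first exact: cyc.
  by rewrite adj_sym cyc.
- by move=> /eqP->; rewrite p0; case: b'.
- by move=> /eqP->; rewrite p0 adj_sym; case: b.
- by case: b b' => [] [] //= _; rewrite // adj_sym.
Qed.

(** * Comparing the size with r^2 - r around a fixed vertex *)

Section Neighbourhood.
Variables (R : realType) (G : sgraph) (u : G).
Local Notation a g h := ((adj (g : G) (h : G))%:R : R).
Let A := [set g : G | adj u g].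
Let B := [set g : G | ~~ adj u g & g != u].
Let dA g := \sum_(h in A) a g h.
Let dB g := \sum_(h in B) a g h.

Lemma sum_neighbourhood (F : G -> R) :
  \sum_g F g = F u + \sum_(g in A) F g + \sum_(g in B) F g.
Proof.
rewrite (bigD1 u) //= -addrA; congr (_ + _).
rewrite (bigID (adj u)) /=; congr (_ + _); apply: eq_bigl => g; rewrite inE.
  by case: eqP => //= ->; rewrite adj_irrefl.
by rewrite andbC.
Qed.

(** The degree sum is split along {u}, [A] and [B]. Edges between [A] and [B] are seen from both
    ends, so they are counted in full through [dA] on [B], while edges inside [A] or [B] need the
    factor 1/2. *)
Lemma edge_count : (#|edges G|%:R : R) =
  #|A|%:R + (\sum_(g in A) dA g) / 2 + \sum_(g in B) dA g + (\sum_(g in B) dB g) / 2.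
Proof.
have dsplit g : \sum_h a g h = a g u + dA g + dB g by exact: sum_neighbourhood.
have cross : \sum_(g in A) dB g = \sum_(g in B) dA g.
  rewrite exchange_big; apply: eq_bigr => g _; apply: eq_bigr => h _.
  by rewrite adj_sym.
have sumA : \sum_(g in A) a g u = #|A|%:R.
  rewrite -sum1_card natr_sum; apply: eq_bigr => g.
  by rewrite inE adj_sym => ->.
have sumB : \sum_(g in B) a g u = 0.
  by apply: big1 => g; rewrite inE adj_sym => /andP[/negPf->].
have dAu : dA u = #|A|%:R.
  by rewrite -sumA; apply: eq_bigr => g _; rewrite adj_sym.
have dBu : dB u = 0.
  by rewrite -sumB; apply: eq_bigr => g _; rewrite adj_sym.
have := congr1 (fun n => n%:R : R) (handshake G).
rewrite natrM natr_sum (eq_bigr (fun g => a g u + dA g + dB g)); last first.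
  by move=> g _; rewrite natr_sum dsplit.
rewrite sum_neighbourhood !big_split /= cross sumA sumB dAu dBu adj_irrefl.
by move: (\sum_(g in A) dA g) => x; rewrite -[false%:R]/(0 : R) => E; lra.
Qed.

(** The left side is the entry of M^2 y at [u], M being the adjacency matrix; walks of length two
    from [u] are sorted by whether they end at [u], in [A] or in [B]. *)
Lemma walk_count (y : G -> R) : y u = 1 ->
  \sum_(g in A) \sum_h a g h * y h =
  #|A|%:R + \sum_(g in A) dA g * y g + \sum_(g in B) dA g * y g.
Proof.
move=> yu; under eq_bigr => g _ do rewrite sum_neighbourhood yu mulr1.
rewrite !big_split /=; congr (_ + _ + _).
- rewrite -sum1_card natr_sum; apply: eq_bigr => g.
  by rewrite inE adj_sym => ->.
- rewrite exchange_big; apply: eq_bigr => g _; rewrite mulr_suml.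
  by apply: eq_bigr => h _; rewrite adj_sym.
- rewrite exchange_big; apply: eq_bigr => g _; rewrite mulr_suml.
  by apply: eq_bigr => h _; rewrite adj_sym.
Qed.

(* When r y <= M y entrywise and 1 <= r, every term on the right other than the
   third is visibly nonnegative. *)
Lemma size_identity (y : G -> R) (r : R) : y u = 1 ->
  #|edges G|%:R - (r ^+ 2 - r) =
  \sum_(g in A) (\sum_h a g h * y h - r * y g)
  + (r - 1) * (\sum_(g in A) y g - r)
  + \sum_(g in A) (dA g / 2 - (dA g - 1) * y g)
  + \sum_(g in B) dA g * (1 - y g) + (\sum_(g in B) dB g) / 2.
Proof.
move=> yu; rewrite edge_count sumrB walk_count // -mulr_sumr.
have -> : \sum_(g in A) (dA g / 2 - (dA g - 1) * y g) =
    (\sum_(g in A) dA g) / 2 - \sum_(g in A) dA g * y g + \sum_(g in A) y g.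
  rewrite mulr_suml -sumrB -big_split; apply: eq_bigr => g _ /=; ring.
have -> : \sum_(g in B) dA g * (1 - y g) =
    \sum_(g in B) dA g - \sum_(g in B) dA g * y g.
  by rewrite -sumrB; apply: eq_bigr => g _; ring.
ring.
Qed.


(** Since y <= 1, each term is at least y - dA/2. The [dA] add up to at most 9, so the sum is at
    least r - 9/2, which exceeds 1. *)
Lemma triangle_slack (y : G -> R) (r : R) : 6 < r -> r <= \sum_(g in A) y g ->
  (forall g, y g <= 1) ->
  (exists x1 x2 x3, forall v w, v \in A -> w \in A -> adj v w ->
     v \in [set x1; x2; x3] /\ w \in [set x1; x2; x3]) ->
  1 < \sum_(g in A) (dA g / 2 - (dA g - 1) * y g).
Proof.
move=> r6 rA y1 [x1 [x2 [x3 T]]]; set X := [set x1; x2; x3] in T.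
have X3 : (#|X| <= 3)%N.
  rewrite /X -(setUA [set x1]) (leq_trans (leq_card_setU _ _)) // cards1.
  by rewrite cards2; case: eqP.
have dA0 g : 0 <= dA g by apply: sumr_ge0 => h _; exact: ler0n.
(* A crude bound: all of [X] is counted, [g] included. *)
have dA3 g : g \in A -> dA g <= (g \in X)%:R * 3.
  move=> gA; have [gX|gX] := boolP (g \in X); last first.
    rewrite mul0r /dA big1 // => h hA; case E : (adj g h) => //.
    by have [] := T _ _ gA hA E; rewrite (negPf gX).
  rewrite mul1r (le_trans (y := \sum_(h in A) (h \in X)%:R)) //.
    apply: ler_sum => h hA; rewrite ler_nat; case E : (adj g h) => //.
    by have [_ ->] := T _ _ gA hA E.
  rewrite -natr_sum ler_nat (leq_trans _ X3) // -sum1_card.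
  rewrite [leqRHS]big_mkcond [leqLHS]big_mkcond /=; apply: leq_sum => h _.
  by case: (h \in X); case: ifP.
have dsum : \sum_(g in A) dA g <= 9.
  apply: (le_trans (ler_sum _ dA3)); rewrite -mulr_suml.
  suff : \sum_(g in A) (g \in X)%:R <= 3 :> R by move=> ?; lra.
  rewrite -natr_sum ler_nat (leq_trans _ X3) // -sum1_card.
  rewrite [leqRHS]big_mkcond [leqLHS]big_mkcond /=; apply: leq_sum => h _.
  by case: (h \in X); case: ifP.
have : \sum_(g in A) (y g - dA g / 2) <=
       \sum_(g in A) (dA g / 2 - (dA g - 1) * y g).
  by apply: ler_sum => g _; have := dA0 g; have := y1 g; nra.
by rewrite sumrB -mulr_suml => ?; lra.
Qed.

Lemma star_slack (y : G -> R) (r : R) (c : G) : 1 < r ->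
  r <= \sum_(g in A) y g -> (forall g, 0 <= y g <= 1) -> c \in A ->
  (forall v w, v \in A -> w \in A -> adj v w -> (v == c) || (w == c)) ->
  let s := \sum_(g in A) (dA g / 2 - (dA g - 1) * y g) in
  1 <= s /\ (s = 1 -> forall v, v \in A -> v != c -> 0 < y v -> adj c v).
Proof.
move=> r1 rA y01 cA star s.
pose L := [set v in A | adj c v].
have dAc : dA c = #|L|%:R.
  rewrite -sum1_card natr_sum /dA [LHS]big_mkcond [RHS]big_mkcond.
  apply: eq_bigr => h _; rewrite [in RHS]inE.
  by case: (h \in A); case: adj.
have dAv v : v \in A -> v != c -> dA v = a c v.
  move=> vA vc; rewrite /dA (bigD1 c) //= adj_sym big1 ?addr0 // => h.
  case/andP=> hA hc; case E : adj => //.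
  by have := star _ _ vA hA E; rewrite (negPf vc) (negPf hc).
have nE : \sum_(g in A | g != c) a c g = #|L|%:R.
  by rewrite -dAc /dA [RHS](bigD1 c) //= adj_irrefl add0r.
(* Half of the leading [#|L|] comes from the centre and half from the leaves, each leaf giving 1/2.
   As y c <= 1, the first two terms are at least 1 once [L] is nonempty; the last sum collects the
   vertices of [A] not joined to [c]. *)
have sE : s = #|L|%:R - (#|L|%:R - 1) * y c
            + \sum_(g in A | g != c) (1 - a c g) * y g.
  rewrite /s (bigD1 c) //= dAc.
  rewrite (eq_bigr (fun g => a c g / 2 + (1 - a c g) * y g)); last first.
    by move=> g /andP[gA gc]; rewrite dAv //; ring.
  by rewrite big_split /= -mulr_suml nE; field.
have W0 g : 0 <= (1 - a c g) * y g.
  case/andP: (y01 g) => y0 _; rewrite mulr_ge0 // subr_ge0.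
  by rewrite lern1 leq_b1.
have WW : 0 <= \sum_(g in A | g != c) (1 - a c g) * y g by apply: sumr_ge0.
case/andP: (y01 c) => yc0 yc1.
(* With no leaf, [s] is the sum of y over [A], which is at least r > 1. *)
case: (posnP #|L|) => [L0|L0].
  have : 1 < s; last by move=> s1; split=> [|E]; [exact: ltW|rewrite E ltxx in s1].
  apply: (lt_le_trans r1); apply: (le_trans rA).
  rewrite sE L0 (bigD1 c) //= [0 - _](_ : _ = y c); last by ring.
  rewrite lerD2l.
  apply: ler_sum => g /andP[gA gc]; case E : (adj c g); last by rewrite subr0 mul1r.
  by have : g \in L; [rewrite inE gA E|rewrite (cards0_eq L0) inE].
have {}L0 : 1 <= #|L|%:R :> R by rewrite ler1n.
split=> [|s1 v vA vc yv]; first by rewrite sE; nra.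
have : \sum_(g in A | g != c) (1 - a c g) * y g = 0.
  by apply/eqP; rewrite eq_le WW andbT; move: s1; rewrite sE; nra.
move/eqP; rewrite psumr_eq0 => [/allP/(_ v (mem_index_enum v))|]; last by [].
rewrite vA vc /= mulf_eq0 (gt_eqF yv) orbF subr_eq0.
by case: adj => //; rewrite oner_eq0.
Qed.

(** In [size_identity] the third term is at least 1 and the others are nonnegative. Equality
    excludes the triangle case and makes the third term exactly 1 and all others 0. *)
Lemma size_bound (y : G -> R) (r : R) :
  6 < r -> (forall g, 0 <= y g <= 1) -> y u = 1 ->
  (forall g, r * y g <= \sum_h a g h * y h) ->
  ~ contains G (cycle_triangle 3) ->
  r ^+ 2 - r <= #|edges G|%:R - 1 /\
  (r ^+ 2 - r = #|edges G|%:R - 1 -> exists c, [/\ c \in A,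
     forall v, v \in A -> v != c -> adj c v,
     forall v w, v \in A -> w \in A -> adj v w -> (v == c) || (w == c) &
     forall w, w \in B -> dB w = 0 /\ dA w * (1 - y w) = 0]).
Proof.
move=> r6 y01 yu sub nobow.
have rA : r <= \sum_(g in A) y g.
  have := sub u; rewrite yu mulr1 => /le_trans; apply.
  rewrite [leRHS]big_mkcond; apply: ler_sum => g _.
  by rewrite inE; case: adj; rewrite ?mul1r ?mul0r.
have dA0 g : 0 <= dA g by apply: sumr_ge0 => h _; exact: ler0n.
have dB0 g : 0 <= dB g by apply: sumr_ge0 => h _; exact: ler0n.
have := size_identity r yu.
set P := \sum_(g in A) _; set Q := (r - 1) * _; set s := \sum_(g in A) _.
set T := \sum_(g in B) dA g * _; set U := \sum_(g in B) _ => id.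
have P0 : 0 <= P by apply: sumr_ge0 => g _; rewrite subr_ge0.
have Q0 : 0 <= Q by rewrite mulr_ge0 ?subr_ge0 //; lra.
have Tg g : 0 <= dA g * (1 - y g).
  by rewrite mulr_ge0 // subr_ge0; case/andP: (y01 g).
have T0 : 0 <= T by apply: sumr_ge0.
have U0 : 0 <= U by apply: sumr_ge0.
have A0 : exists c, c \in A.
  apply/set0Pn; apply: contraTneq rA => ->.
  by rewrite big_set0 -ltNge; lra.
(* Two disjoint edges in [A] would give two triangles sharing only [u], that is, H(3,3). *)
have meet x1 x2 x3 x4 : x1 \in A -> x2 \in A -> x3 \in A -> x4 \in A ->
    adj x1 x2 -> adj x3 x4 -> [|| x1 == x3, x1 == x4, x2 == x3 | x2 == x4].
  rewrite !inE => u1 u2 u3 u4 e12 e34; apply: contra_notT nobow.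
  rewrite !negb_or => /and4P[n13 n14 n23 n24].
  apply: (@contains_cycle_triangle G 3 [:: u; x1; x2] u x3 x4) => //.
    by case=> [|[|[|]]] //= _; rewrite adj_sym.
  have ne (x z : G) : adj x z -> x != z.
    by apply: contraTneq => ->; rewrite adj_irrefl.
  rewrite /= !inE !negb_or (ne _ _ e34) (ne _ _ e12) (ne _ _ u1) (ne _ _ u2).
  rewrite !(eq_sym x3) !(eq_sym x4) (ne _ _ u3) (ne _ _ u4) n13 n14 n23 n24.
  by [].
have [[c cA star]|tri] := intersecting_edges (@adj_sym G) (@adj_irrefl G) A0 meet.
  have [s1 s1eq] := star_slack (ltac:(lra) : 1 < r) rA y01 cA star.
  rewrite -/s in s1 s1eq; split; first by lra.
  move=> E; have sE : s = 1 by lra.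
  have PE : P = 0 by lra.
  have TE : T = 0 by lra.
  have UE : U = 0 by lra.
  exists c; split=> // [v vA vc|w wB].
    apply: s1eq => //; move/eqP: PE; rewrite psumr_eq0; last first.
      by move=> g _; rewrite subr_ge0.
    move=> /allP/(_ v (mem_index_enum v)); rewrite vA subr_eq0 => /eqP PE.
    (* [star_slack] only reaches vertices with y > 0. As [P] vanishes, r y v equals the neighbour
       sum at [v], to which [u] alone contributes 1. *)
    have : 1 <= r * y v; last by move=> H; have /andP[] := y01 v; nra.
    rewrite -PE (bigD1 u) //= yu mulr1; rewrite inE in vA.
    rewrite adj_sym vA lerDl; apply: sumr_ge0 => h _.
    by rewrite mulr_ge0 ?ler0n //; case/andP: (y01 h).
  split.
    move/eqP: UE; rewrite psumr_eq0 // => /allP/(_ w (mem_index_enum w)).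
    by rewrite wB => /eqP.
  move/eqP: TE; rewrite psumr_eq0 // => /allP/(_ w (mem_index_enum w)).
  by rewrite wB => /eqP.
have y1 g : y g <= 1 by case/andP: (y01 g).
have := triangle_slack r6 rA y1 tri; rewrite -/s => s1.
by split=> [|E]; lra.
Qed.

End Neighbourhood.

(** * Structure of the graph in the equality case *)

Lemma outside_empty (R : realType) (G : sgraph) (u c : G) (y : G -> R) (r : R) :
  6 < r -> (forall g, 0 <= y g <= 1) -> y u = 1 ->
  (forall g, r * y g <= \sum_h (adj g h)%:R * y h) ->
  no_isolated G -> ~ contains G (cycle_triangle 4) ->
  adj u c -> (forall v, adj u v -> v != c -> adj c v) ->
  (forall w, ~~ adj u w -> w != u ->
     (forall z, adj w z -> adj u z) /\ forall z, adj w z -> adj u z -> y w = 1) ->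
  forall w, w != u -> adj u w.
Proof.
move=> r6 y01 yu sub noiso noH uc cA out w wu; apply/negPn/negP => uw.
have [wA yw] := out w uw wu.
have [z wz] := noiso w.
(* Where y = 1, the neighbour sum is at least r, and each neighbour contributes at most 1. *)
have deg g : y g = 1 -> (6 < #|[set h | adj g h]|)%N.
  move=> yg; have := sub g; rewrite yg mulr1 -(ltr_nat R) => rg.
  apply: (lt_le_trans r6); apply: (le_trans rg).
  rewrite -sum1_card natr_sum [leRHS]big_mkcond; apply: ler_sum => h _.
  by rewrite inE; case: adj; rewrite ?mul0r // mul1r; case/andP: (y01 h).
have pickN (S D : {set G}) : (#|D| < #|S|)%N -> exists2 v, v \in S & v \notin D.
  move=> DS; apply/exists_inP; apply: contraTT DS; rewrite negb_exists_in -leqNgt.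
  by move=> /forall_inP H; apply/subset_leq_card/subsetP => v /H /negPn.
have [v1 /[!inE] wv1 v1c] : exists2 v, v \in [set h | adj w h] & v \notin [set c].
  by apply: pickN; rewrite cards1 (leq_trans _ (deg _ (yw z wz (wA z wz)))).
have [v2 /[!inE] wv2] : exists2 v, v \in [set h | adj w h] & v \notin [set c; v1].
  apply: pickN; rewrite (leq_trans _ (deg _ (yw z wz (wA z wz)))) // ltnS.
  by rewrite cards2; case: eqP.
rewrite negb_or => /andP[v2c v21].
have [v3 /[!inE] uv3] : exists2 v, v \in [set h | adj u h] & v \notin [set c; v1; v2].
  apply: pickN; rewrite (leq_trans _ (deg _ yu)) // ltnS -setUA.
  by rewrite (leq_trans (leq_card_setU _ _)) // cards1 cards2; case: eqP.
rewrite !negb_or => /andP[/andP[v3c v31] v32].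
(* The 4-cycle u v1 w v2 and the triangle u c v3 share only [u]. *)
apply: noH; apply: (@contains_cycle_triangle G 4 [:: u; v1; w; v2] u c v3) => //.
- by case=> [|[|[|[|]]]] //= _; rewrite ?wA // adj_sym // wA.
- have ne (x t : G) : adj x t -> x != t.
    by apply: contraTneq => ->; rewrite adj_irrefl.
  have wn x : adj u x -> x != w by apply: contraTneq => ->.
  rewrite /= !inE !negb_or !(eq_sym c) v3c (ne _ _ uc) v1c v2c.
  rewrite [w == c]eq_sym (wn _ uc) (eq_sym v3 u) (ne _ _ uv3) v31 (wn _ uv3) v32.
  rewrite (ne _ _ (wA _ wv1)) (eq_sym u w) wu (ne _ _ (wA _ wv2)).
  by rewrite (wn _ (wA _ wv1)) eq_sym v21 (ne _ _ wv2).
- exact: cA.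
Qed.

Lemma isomorphic_complete_split2 (G : sgraph) (u c : G) :
  adj u c -> (forall v, v != u -> adj u v) -> (forall v, v != c -> adj c v) ->
  (forall v w, adj v w -> [|| v == u, v == c, w == u | w == c]) ->
  isomorphic G (complete_split ((#|edges G| + 3) %/ 2) 2).
Proof.
move=> uc Nu Nc E.
have nuc : u != c by apply: contraTneq uc => ->; rewrite adj_irrefl.
pose L := ~: [set u; c].
have cardL : #|L| = (#|G| - 2)%N by rewrite cardsCs setCK cards2 nuc.
have G2 : (2 <= #|G|)%N.
  by have := max_card (mem [set u; c]); rewrite cards2 nuc.
have degree (x : G) : (forall v, v != x -> adj x v) ->
    (\sum_h adj x h = #|G| - 1)%N.
  move=> Nx; rewrite -(cards1 x) -cardsT -[in RHS](setIidPr (subsetT [set x])).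
  rewrite -cardsD -sum1_card [RHS]big_mkcond; apply: eq_bigr => h _; rewrite !inE andbT.
  by case: eqP => [->|/eqP/Nx->] //=; rewrite adj_irrefl.
have LP v : v \in L -> (v != u) /\ (v != c).
  by rewrite !inE negb_or => /andP[].
have degreeL v : v \in L -> (\sum_h adj v h = 2)%N.
  case/LP=> vu vc; rewrite (bigD1 u) //= (bigD1 c) 1?eq_sym //= big1 => [|h].
    by rewrite adj_sym Nu // adj_sym Nc.
  case/andP=> hu hc; case e : adj => //; have := E _ _ e.
  by rewrite (negPf vu) (negPf vc) (negPf hu) (negPf hc).
(* With N vertices, the degree sum is 2(N - 1) + 2(N - 2), so there are 2N - 3 edges. *)
have -> : ((#|edges G| + 3) %/ 2 = #|G|)%N.
  have := handshake G; rewrite (bigD1 u) //= degree // (bigD1 c) 1?eq_sym //=.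
  rewrite degree // (eq_bigl (mem L)) => [|v]; last by rewrite !inE negb_or.
  rewrite (eq_bigr (fun=> 2%N)) // sum_nat_const cardL.
  by move: G2 #|edges G|; move: #|G| => N; lia.
(* The isomorphism is built backwards, from the split graph to [G]; injectivity and equal orders
   make it bijective. *)
pose f' (z : 'I_2 + 'I_(#|G| - 2)) : G := match z with
  | inl i => if i == ord0 then u else c
  | inr j => enum_val (cast_ord (esym cardL) j) end.
have f'L j : f' (inr j) \in L by exact: enum_valP.
have f'adj z t : adj (f' z) (f' t) = complete_split_adj z t.
  case: z t => [i|j] [i'|j'].
  - rewrite /=; case: i i' => [[|[|//]] ?] [[|[|//]] ?];
      by rewrite /= ?adj_irrefl // adj_sym.
  - have [? ?] := LP _ (f'L j'); rewrite [complete_split_adj _ _]/=.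
    by rewrite [f' (inl _)]/=; case: ifP => _; rewrite (Nu, Nc).
  - have [? ?] := LP _ (f'L j); rewrite [complete_split_adj _ _]/= adj_sym.
    by rewrite [f' (inl _)]/=; case: ifP => _; rewrite (Nu, Nc).
  - have [nu nc] := LP _ (f'L j); have [nu' nc'] := LP _ (f'L j').
    apply/negP => /E.
    by rewrite (negPf nu) (negPf nc) (negPf nu') (negPf nc').
have f'inj : injective f'.
  move=> [i|j] [i'|j'].
  - case: i i' => [[|[|//]] ?] [[|[|//]] ?] /= e; try by congr inl; exact: val_inj.
      by rewrite e eqxx in nuc.
    by rewrite -e eqxx in nuc.
  - have [/eqP nu /eqP nc] := LP _ (f'L j').
    by rewrite [f' (inl _)]/=; case: ifP => _ /esym.
  - have [/eqP nu /eqP nc] := LP _ (f'L j).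
    by rewrite [f' (inl _)]/=; case: ifP.
  - by move=> /enum_val_inj/cast_ord_inj->.
have [f fK f'K] : bijective f'.
  by apply: inj_card_bij => //; rewrite card_sum !card_ord subnKC.
exists f; split; first by exists f'.
by move=> x t; rewrite -[in RHS](f'K x) -[in RHS](f'K t) f'adj.
Qed.

Lemma eigenvalue_size_bound (R : realType) (G : sgraph) (r : R) :
  6 < r -> no_isolated G ->
  ~ contains G (cycle_triangle 3) -> ~ contains G (cycle_triangle 4) ->
  eigenvalue (adjmx R G) r ->
  r ^+ 2 - r <= #|edges G|%:R - 1 /\
  (r ^+ 2 - r = #|edges G|%:R - 1 ->
   isomorphic G (complete_split ((#|edges G| + 3) %/ 2) 2)).
Proof.
move=> r6 noiso noH3 noH4 /eigenvalue_adjmxP[x [g0 xg0] xE].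
case: (@Order.TotalTheory.arg_maxP _ _ _ g0 xpredT (fun g => `|x g|)) => // u _ xu.
have xu0 : 0 < `|x u| by rewrite (lt_le_trans _ (xu g0 isT)) ?normr_gt0.
pose y g := `|x g| / `|x u|.
have y01 g : 0 <= y g <= 1.
  by rewrite divr_ge0 //= ler_pdivrMr // mul1r; exact: xu.
have yu : y u = 1 by rewrite /y divff // gt_eqF.
(* The triangle inequality applied to the eigenvector equation. *)
have sub g : r * y g <= \sum_h (adj g h)%:R * y h.
  have -> : \sum_h (adj g h)%:R * y h = (\sum_h (adj g h)%:R * `|x h|) / `|x u|.
    by rewrite mulr_suml; apply: eq_bigr => h _; rewrite mulrA.
  rewrite mulrA ler_pM2r ?invr_gt0 //.
  rewrite -{1}[r]gtr0_norm; last by lra.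
  rewrite -normrM -xE (le_trans (ler_norm_sum _ _ _)) //.
  by apply: ler_sum => h _; rewrite normrM normr_nat.
have [bound eq] := size_bound r6 y01 yu sub noH3; split=> // /eq[c []].
rewrite inE => uc cA star out.
have all_u : forall w, w != u -> adj u w.
  apply: (outside_empty r6 y01 yu sub noiso noH4 uc).
    by move=> v uv; apply: cA; rewrite inE.
  move=> w uw wu; have [|dB dA] := out w; first by rewrite inE uw.
  (* [dB] vanishes at [w], and [u] is no neighbour of [w], so every neighbour of [w] lies in
     N(u). *)
  have wN z : adj w z -> adj u z.
    move=> wz; apply: contraTT isT => uz.
    move/eqP: dB; rewrite psumr_eq0 => [/allP/(_ z (mem_index_enum z))|h _].
      rewrite inE uz wz /= oner_eq0 (contraTneq _ wz) // => ->.
      by rewrite adj_sym.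
    exact: ler0n.
  split=> // z wz uz; move/eqP: dA; rewrite mulf_eq0 => /orP[|]; last first.
    by rewrite subr_eq0 => /eqP.
  rewrite psumr_eq0 => [/allP/(_ z (mem_index_enum z))|h _]; last exact: ler0n.
  by rewrite inE uz wz oner_eq0.
apply: (isomorphic_complete_split2 uc all_u) => [v vc|v w vw].
  by have [->|/all_u uv] := eqVneq v u; [rewrite adj_sym|apply: cA; rewrite ?inE].
have [//|vu] := eqVneq v u; have [|wu] := eqVneq w u; first by rewrite !orbT.
by have := star v w; rewrite !inE !all_u //= => /(_ isT isT vw).
Qed.

(** * The extremal graph and the conclusion *)

Lemma eigenvalue_complete_split2 (R : realType) (G : sgraph) (n : nat) (r : R) :
  isomorphic G (complete_split n 2) ->
  (0 < #|G|)%N -> r != 0 -> r ^+ 2 - r = 2 * (n - 2)%:R ->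
  eigenvalue (adjmx R G) r.
Proof.
move=> [f [fbij fadj]] /card_gt0P[g0 _] r0 rE; apply/eigenvalue_adjmxP.
(* An eigenvector constant on both parts: the equations are r + 2(n - 2) = r^2 on K_2 and 2r = 2r on
   the independent set. *)
pose X (z : 'I_2 + 'I_(n - 2)) : R := if z is inl _ then r else 2.
exists (fun g => X (f g)) => [|g].
  by exists g0; rewrite /X; case: (f g0) => // _; rewrite pnatr_eq0.
transitivity (\sum_(z : 'I_2 + 'I_(n - 2))
                (complete_split_adj (f g) z)%:R * X z).
  rewrite [RHS](reindex f); last exact: onW_bij.
  by apply: eq_bigr => h _; rewrite -fadj.
rewrite big_sumType /= 2!big_ord_recl big_ord0; case: (f g) => [i|j] /=.
  under eq_bigr => h _ do rewrite mul1r.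
  rewrite sumr_const card_ord -[2 *+ _]mulr_natr -rE.
  by case: i => [[|[|//]] ?] /=; rewrite ?mul1r ?mul0r; ring.
under eq_bigr => h _ do rewrite mul0r.
by rewrite sumr_const mul0rn; ring.
Qed.

Theorem theorem1p1 (R : realType) (m : nat) (G : sgraph) :
  (259 <= m)%N -> odd m ->
  #|edges G| = m -> no_isolated G ->
  family_free (fun H => H = cycle_triangle 3 \/ H = cycle_triangle 4) G ->
  spectral_radius R G <= (1 + Num.sqrt (4 * m%:R - 3)) / 2 /\
  (spectral_radius R G = (1 + Num.sqrt (4 * m%:R - 3)) / 2 <->
   isomorphic G (complete_split ((m + 3) %/ 2) 2)).
Proof.
move=> m259 oddm mE noiso free.
have noH3 : ~ contains G (cycle_triangle 3) by apply: free; left.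
have noH4 : ~ contains G (cycle_triangle 4) by apply: free; right.
have G0 : (0 < #|G|)%N.
  have : (0 < #|edges G|)%N by rewrite mE; lia.
  by case/card_gt0P=> e /imsetP[[g h] _ _]; apply/card_gt0P; exists g.
have [rho_eig rho_max] := spectral_radiusP R G0.
move: (spectral_radius R G) rho_eig rho_max => rho rho_eig rho_max.
have m259R : 259 <= m%:R :> R by rewrite ler_nat.
have qq : Num.sqrt (4 * m%:R - 3) ^+ 2 = 4 * m%:R - 3 :> R.
  by rewrite sqr_sqrtr //; lra.
have q0 : 0 <= Num.sqrt (4 * m%:R - 3) :> R by exact: sqrtr_ge0.
move: (Num.sqrt _) qq q0 => q qq q0.
(* From m >= 259, q^2 >= 1033 > 144; hence (1 + q)/2 passes the threshold 6. *)
have q12 : 12 < q by rewrite -(ltr_pXn2r (n := 2)) ?nnegrE // qq; lra.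
have bound : rho <= (1 + q) / 2.
  case: (lerP rho ((1 + q) / 2)) => // rho_gt.
  have r6 : 6 < rho by lra.
  (* The roots of t^2 - t - (m - 1) are (1 + q)/2 and (1 - q)/2, so this product is rho^2 - rho - (m
     - 1). *)
  have prod : 0 < (rho - (1 + q) / 2) * (rho + (q - 1) / 2).
    by rewrite mulr_gt0 //; lra.
  have gt : m%:R - 1 < rho ^+ 2 - rho by lra.
  by have [] := eigenvalue_size_bound r6 noiso noH3 noH4 rho_eig; rewrite mE lt_geF.
split=> //; split=> [rhoE|iso].
  have r6 : 6 < rho by lra.
  have [_] := eigenvalue_size_bound r6 noiso noH3 noH4 rho_eig.
  by rewrite mE; apply; rewrite rhoE; lra.
(* It suffices that (1 + q)/2 is an eigenvalue, since [rho] is the largest. *)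
apply/eqP; rewrite eq_le bound rho_max //.
apply: (eigenvalue_complete_split2 iso G0); first by rewrite gt_eqF //; lra.
(* Oddness of [m] makes the division exact, so 2(n - 2) = m - 1 for n = (m + 3)/2. *)
have : (2 * ((m + 3) %/ 2 - 2) + 1 = m)%N by lia.
by move=> /(congr1 (fun k => k%:R : R)); rewrite natrD natrM => ?; lra.
Qed.
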